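(* Every 2-tree is odd $4$-colorable.
   Context: All graphs are simple, finite and undirected. A $4$-coloring of a graph $G$ is a map $\varphi:V(G)\to\{1,2,3,4\}$ with $\varphi(u)\neq\varphi(v)$ for every edge $uv$. A vertex $v$ satisfies the odd condition with respect to $\varphi$ if $|\varphi^{-1}(i)\cap N_G(v)|$ is odd for some color $i$. An odd $4$-coloring is a $4$-coloring in which every non-isolated vertex satisfies the odd condition. A graph $G$ is a 2-tree if there is a sequence $G_0,\dots,G_s$ of induced subgraphs of $G$ with $G_0\cong K_3$, $G_s=G$, and for each $i\in\{1,\dots,s\}$, $V(G_i)=V(G_{i-1})\cup\{x_i\}$ for a new vertex $x_i$ whose neighbors in $V(G_{i-1})$ form a clique of order $2$ (an edge) of $G$. *)

(* Defs.v *)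
From mathcomp Require Import all_boot.

Set Implicit Arguments.
Unset Strict Implicit.
Unset Printing Implicit Defensive.

Record sgraph := SGraph {
  vertex :> finType;
  adj : rel vertex;
  adj_sym : symmetric adj;
  adj_irrefl : irreflexive adj }.

Definition nbh (G : sgraph) (v : G) : {set G} := [set u | adj v u].

Definition isolated (G : sgraph) (v : G) : Prop := nbh v = set0.

Definition coloring (k : nat) (G : sgraph) (phi : G -> 'I_k) : Prop :=
  forall u v : G, adj u v -> phi u <> phi v.

Definition odd_condition (k : nat) (G : sgraph) (phi : G -> 'I_k) (v : G) :
    Prop :=
  exists i : 'I_k, odd #|(phi @^-1: [set i]) :&: nbh v|.

Definition odd_coloring (k : nat) (G : sgraph) (phi : G -> 'I_k) : Prop :=
  coloring phi /\ forall v : G, ~ isolated v -> odd_condition phi v.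

Definition odd_colorable (k : nat) (G : sgraph) : Prop :=
  exists phi : G -> 'I_k, odd_coloring phi.

Definition clique (G : sgraph) (k : nat) (A : {set G}) : Prop :=
  #|A| = k /\ {in A &, forall u v : G, u != v -> adj u v}.

(* f is an isomorphism from K_n, with vertex set 'I_n, onto G[A]. *)
Definition induces_complete (G : sgraph) (n : nat) (A : {set G}) : Prop :=
  exists f : 'I_n -> G,
    [/\ injective f, f @: 'I_n = A
      & forall i j : 'I_n, adj (f i) (f j) = (i != j)].

(* An induced subgraph is determined by its vertex set, so the sequence of
   induced subgraphs G_0, ..., G_s is given by the sets V i = V(G_i); the
   values V i with i > s are irrelevant. *)
Definition two_tree (G : sgraph) : Prop :=
  exists (s : nat) (V : nat -> {set G}),
    [/\ induces_complete 3 (V 0), V s = [set: G]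
      & forall i : nat, 1 <= i <= s ->
          exists x : G,
            [/\ x \notin V i.-1, V i = x |: V i.-1
              & clique 2 (nbh x :&: V i.-1)]].

(* Main.v *)
Require Import Defs.
From mathcomp Require Import all_boot.
From HB Require Import structures.
From Stdlib Require Import NArith.

(** A vertex [v] is recorded by its parity mask, the binary number whose [i]-th
    bit is the parity of the number of neighbors of [v] with color [i]; the odd
    condition says that the mask is nonzero.  Removing the last vertex [x] of a
    2-tree, with neighbors [a] and [b], leaves on the edge [ab] a constraint:
    the set of pairs of masks that the removed part can contribute to [a] and
    [b], given their colors.  So we color 2-trees whose edges carry constraints
    ("gadgets").  An elimination step puts two gadgets in series at [x] and the
    result in parallel with the gadget of [ab].  Up to inclusion, only finitely
    many gadgets arise from a plain edge in this way, and each of them admits a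
    pair of nonzero masks, which settles the base case of a single edge. *)

Set Implicit Arguments.
Unset Strict Implicit.
Unset Printing Implicit Defensive.

HB.instance Definition _ := Monoid.isComLaw.Build N 0%num N.lxor
  (fun x y z => esym (N.lxor_assoc x y z)) N.lxor_comm N.lxor_0_l.

Definition color_bit (c : nat) : N := (2 ^ N.of_nat c)%num.

(* Unlike [all] and [has], these stop early under call-by-value reduction. *)
Fixpoint all_lazy (T : Type) (P : T -> bool) (s : seq T) : bool :=
  if s is x :: s' then (if P x then all_lazy P s' else false) else true.

Fixpoint has_lazy (T : Type) (P : T -> bool) (s : seq T) : bool :=
  if s is x :: s' then (if P x then true else has_lazy P s') else false.

Definition member (S : seq (N * N)) (x : N * N) : bool :=
  has_lazy (fun y => if N.eqb x.1 y.1 then N.eqb x.2 y.2 else false) S.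

Definition contains (S T : seq (N * N)) : bool := all_lazy (member S) T.

Definition dedup (S : seq (N * N)) : seq (N * N) :=
  foldr (fun x T => if member T x then T else x :: T) [::] S.

(** * The finite family of gadgets *)

(* A gadget lists the pairs of masks allowed when the ends of the edge have
   colors 0 and 1; other pairs of colors are reached by [relabel]. *)
Definition gadget := seq (N * N).

Definition colors : seq nat := [:: 0; 1; 2; 3].

(** For distinct [c] and [d], [pi] is a permutation of the colors; increasing order for its last two
    entries is an arbitrary choice. *)
Definition relabel (c d : nat) (m : N) : N :=
  let pi := [:: c, d & [seq e <- colors | (e != c) && (e != d)]] in
  foldr (fun i r =>
    if N.testbit m (N.of_nat i) then N.lxor (color_bit (nth 0 pi i)) r else r)
    0%num colors.

Definition place (A : gadget) (c d : nat) : seq (N * N) :=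
  [seq (relabel c d x.1, relabel c d x.2) | x <- A].

(** The middle vertex has color [f]. Its mask is the xor of two contributions, nonzero exactly when
    they differ. *)
Definition series (A B : gadget) (c d : nat) : seq (N * N) :=
  flatten [seq [seq (yz.1.1, yz.2.1) |
      yz <- [seq (y, z) | y <- place A c f, z <- place B d f] & yz.1.2 != yz.2.2]
    | f <- colors & (f != c) && (f != d)].

Definition parallel (S T : seq (N * N)) : seq (N * N) :=
  [seq (N.lxor y.1 z.1, N.lxor y.2 z.2) | y <- S, z <- T].

(** Fewer allowed pairs mean a stronger restriction, so a gadget containing another one is
    redundant. *)
Definition minimal (F : seq gadget) : seq gadget :=
  foldr (fun A M => if has_lazy (contains A) M then M
                    else A :: [seq B <- M | ~~ contains B A]) [::] F.

Definition all_series (F : seq gadget) : seq gadget :=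
  minimal [seq dedup (series A B 0 1) | A <- F, B <- F].

Definition saturate (F : seq gadget) : seq gadget :=
  minimal (F ++ [seq dedup (parallel C L) | C <- F, L <- all_series F]).

Definition plain_edge : gadget := [:: (color_bit 1, color_bit 0)].

(* After five rounds nothing new appears up to inclusion: [gadgets_series] and
   [gadgets_parallel] certify this. *)
Definition gadgets : seq gadget :=
  Eval vm_compute in iter 5 saturate [:: plain_edge].

(* Going through the minimal series gadgets keeps the certificates quadratic, not
   cubic, in the number of gadgets. *)
Definition links : seq gadget := Eval vm_compute in all_series gadgets.

Definition color_pairs : seq (nat * nat) :=
  [seq cd <- [seq (c, d) | c <- colors, d <- colors] | cd.1 != cd.2].

Definition table (S : nat -> nat -> seq (N * N)) : seq (seq (N * N)) :=
  [seq S cd.1 cd.2 | cd <- color_pairs].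

(** One [D] must work for all ordered pairs of distinct colors at once, so no compatibility of
    [series] or [parallel] with [relabel] is assumed. *)
Definition refined_in (F : seq gadget) (S : seq (seq (N * N))) : bool :=
  has_lazy (fun D => all_lazy (fun ST => contains ST.1 ST.2)
                       (zip S (table (place D)))) F.

Lemma plain_edge_gadget : plain_edge \in gadgets.
Proof. by vm_compute. Qed.

Lemma gadgets_series :
  all (fun A => all (fun B => refined_in links (table (series A B))) gadgets)
    gadgets.
Proof. by vm_compute. Qed.

Lemma gadgets_parallel :
  all (fun C => all (fun L => refined_in gadgets
    (table (fun c d => parallel (place C c d) (place L c d)))) links) gadgets.
Proof. by vm_compute. Qed.

Lemma gadgets_nonzero :
  all (fun A => has (fun x => (x.1 != 0%num) && (x.2 != 0%num)) (place A 0 1))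
    gadgets.
Proof. by vm_compute. Qed.

(** * Soundness of the computed checks *)

Lemma all_lazyE (T : Type) (P : T -> bool) (s : seq T) : all_lazy P s = all P s.
Proof. by elim: s => //= x s ->; case: (P x). Qed.

Lemma has_lazyE (T : Type) (P : T -> bool) (s : seq T) : has_lazy P s = has P s.
Proof. by elim: s => //= x s ->; case: (P x). Qed.

Lemma memberP (S : seq (N * N)) (x : N * N) : member S x -> x \in S.
Proof.
rewrite /member has_lazyE => /hasP[[p q] Sy] /=.
case: x => p' q' /=; case: (N.eqb_spec p' p) => // -> /N.eqb_eq -> //.
Qed.

Lemma containsP (S T : seq (N * N)) : contains S T -> {subset T <= S}.
Proof. by rewrite /contains all_lazyE => /allP TS x /TS/memberP. Qed.

Lemma mem_colors (c : nat) : (c \in colors) = (c < 4).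
Proof. by rewrite (_ : colors = iota 0 4) // mem_iota. Qed.

Lemma refined_inP (F : seq gadget) (S : nat -> nat -> seq (N * N)) :
  refined_in F (table S) ->
  exists2 D, D \in F &
    forall c d : 'I_4, c != d -> {subset place D c d <= S c d}.
Proof.
rewrite /refined_in has_lazyE => /hasP[D FD]; rewrite all_lazyE => SD.
exists D => // c d neq_cd; apply: containsP.
have: ((c : nat), (d : nat)) \in color_pairs.
  rewrite mem_filter (neq_cd : nat_of_ord c != d).
  by apply: allpairs_f; rewrite mem_colors.
move: SD; rewrite /table; elim: color_pairs => //= cd s IHs /andP[SD1 SDs].
by rewrite inE => /predU1P[e | /(IHs SDs)//]; move: SD1; rewrite -e.
Qed.

Lemma seriesP (A B : gadget) (c d : 'I_4) (p q : N) :
  (p, q) \in series A B c d ->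
  exists (f : 'I_4) (r s : N),
    [/\ f != c, f != d, r != s, (p, r) \in place A c f & (q, s) \in place B d f].
Proof.
case/flattenP => l /mapP[f]; rewrite mem_filter mem_colors.
case/andP=> /andP[fc fd] f4 -> /mapP[[[p' r] [q' s]]].
rewrite mem_filter => /andP[/= rs] /allpairsP[[y z] /= [Ay Bz [ey1 ez1]]] [-> ->].
by exists (Ordinal f4), r, s; split=> //; rewrite ?ey1 ?ez1.
Qed.

Lemma parallelP (S T : seq (N * N)) (p q : N) :
  (p, q) \in parallel S T ->
  exists p1 q1 p2 q2, [/\ (p1, q1) \in S, (p2, q2) \in T,
    p = N.lxor p1 p2 & q = N.lxor q1 q2].
Proof.
by case/allpairsP=> [[[p1 q1] [p2 q2]] /= [Sy Tz [-> ->]]]; exists p1, q1, p2, q2.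
Qed.

(** * Constrained colorings *)

(* The colors of the two ends of an edge, then the masks contributed to them. *)
Definition constraint := 'I_4 -> 'I_4 -> N -> N -> Prop.

Definition realizable (R : constraint) : Prop :=
  exists2 A, A \in gadgets &
    forall (c d : 'I_4) p q, c != d -> (p, q) \in place A c d -> R c d p q.

(* The constraint left on [ab] by removing a vertex [x] adjacent to [a] and [b],
   if [C], [A], [B] are the constraints on [ab], [ax], [bx]. *)
Definition eliminate (C A B : constraint) : constraint := fun c d p q =>
  exists (f : 'I_4) (r s p1 q1 p2 q2 : N),
    [/\ f != c, f != d & r != s] /\
    [/\ C c d p1 q1, A c f p2 r, B d f q2 s, p = N.lxor p1 p2 & q = N.lxor q1 q2].

Lemma eliminate_sym (C C' A B : constraint) c d p q :
  (forall p1 q1, C c d p1 q1 -> C' d c q1 p1) ->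
  eliminate C A B c d p q -> eliminate C' B A d c q p.
Proof.
move=> CC' [f] [r] [s] [p1] [q1] [p2] [q2] [[fc fd rs] [/CC' Cpq Apr Bqs ep eq]].
by exists f, s, r, q1, p1, q2, p2; split; split=> //; rewrite eq_sym.
Qed.

(** The certificates compose: [A] and [B] in series contain a gadget of [links], which in parallel
    with the gadget of [C] contains one of [gadgets]. *)
Lemma realizable_eliminate (C A B : constraint) :
  realizable C -> realizable A -> realizable B -> realizable (eliminate C A B).
Proof.
case=> gC FC CP [gA FA AP] [gB FB BP].
have /refined_inP[gL FL LP] := allP (allP gadgets_series _ FA) _ FB.
have /refined_inP[gD FD DP] := allP (allP gadgets_parallel _ FC) _ FL.
exists gD => // c d p q cd /(DP _ _ cd)/parallelP[p1] [q1] [p2] [q2].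
case=> /(CP _ _ _ _ cd) Cpq /(LP _ _ cd)/seriesP[f] [r] [s] [fc fd rs Apr Bqs] -> ->.
exists f, r, s, p1, q1, p2, q2; split=> //.
by split=> //; [apply: AP | apply: BP] => //; rewrite eq_sym.
Qed.

Definition mask (G : sgraph) (V : {set G}) (P : G -> G -> N) (v : G) : N :=
  \big[N.lxor/0%num]_(u in V | adj v u) P v u.

(* [P u v] is the mask contributed to [u] by the edge [uv]. *)
Definition constrained_colorable (G : sgraph) (V : {set G}) : Prop :=
  forall g : G -> G -> constraint,
    (forall u v, realizable (g u v)) ->
    (forall u v c d p q, g u v c d p q -> g v u d c q p) ->
    exists (phi : G -> 'I_4) (P : G -> G -> N),
      (forall u v, u \in V -> v \in V -> adj u v ->
         phi u != phi v /\ g u v (phi u) (phi v) (P u v) (P v u)) /\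
      (forall v, v \in V -> mask V P v != 0%num).

Lemma maskU1 (G : sgraph) (V : {set G}) (P : G -> G -> N) (x v : G) :
  x \notin V ->
  mask (x |: V) P v = N.lxor (if adj v x then P v x else 0%num) (mask V P v).
Proof. by move=> xV; rewrite /mask big_mkcondr big_setU1 //= -big_mkcondr. Qed.

Lemma eq_mask (G : sgraph) (V : {set G}) (P Q : G -> G -> N) (v : G) :
  (forall u, u \in V -> adj v u -> P v u = Q v u) -> mask V P v = mask V Q v.
Proof. by move=> PQ; apply: eq_bigr => u /andP[]; apply: PQ. Qed.

Lemma mask_update (G : sgraph) (V : {set G}) (P Q : G -> G -> N) (a b : G) m :
  b \in V -> adj a b -> P a b = N.lxor (Q a b) m ->
  (forall u, u \in V -> adj a u -> u != b -> P a u = Q a u) ->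
  mask V P a = N.lxor m (mask V Q a).
Proof.
move=> bV ab eb PQ; rewrite /mask (bigD1 b) ?bV //= [in RHS](bigD1 b) ?bV //=.
rewrite eb (eq_bigr (Q a)); last by move=> u /andP[/andP[uV au] ub]; apply: PQ.
by rewrite (N.lxor_comm _ m) N.lxor_assoc.
Qed.

Lemma constrained_colorable_edge (G : sgraph) (a b : G) :
  adj a b -> constrained_colorable [set a; b].
Proof.
move=> ab g gP gsym; have neq_ab: a != b.
  by apply: contraTneq ab => ->; rewrite adj_irrefl.
have neq_ba: (b == a) = false by rewrite eq_sym (negPf neq_ab).
have [A FA AP] := gP a b.
have /hasP[[p q] Apq /= /andP[p0 q0]] := allP gadgets_nonzero _ FA.
have {Apq} gab := AP (@Ordinal 4 0 isT) (@Ordinal 4 1 isT) p q isT Apq.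
exists (fun u => if u == a then @Ordinal 4 0 isT else @Ordinal 4 1 isT).
exists (fun u _ => if u == a then p else q); split.
  move=> u v /set2P[] -> /set2P[] ->; rewrite ?adj_irrefl // => _.
    by rewrite eqxx neq_ba.
  by rewrite eqxx neq_ba; split=> //; apply: gsym.
have ba : adj b a by rewrite adj_sym.
have mE v : mask [set a; b] (fun u _ => if u == a then p else q) v =
    N.lxor (if adj v a then if v == a then p else q else 0%num)
           (if adj v b then if v == a then p else q else 0%num).
  rewrite maskU1 ?inE // /mask; congr N.lxor.
  by rewrite big_mkcondr big_set1.
move=> v /set2P[] ->; rewrite mE adj_irrefl ?ab ?ba ?eqxx ?neq_ba //.
by rewrite N.lxor_0_r.
Qed.

(** Color [V] with the constraint on [ab] replaced by its elimination; the witnesses of that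
    elimination give the color of [x] and the masks on [ab], [ax] and [bx]. *)
Lemma constrained_colorable_extend (G : sgraph) (V : {set G}) (x : G) :
  x \notin V -> clique 2 (nbh x :&: V) ->
  constrained_colorable V -> constrained_colorable (x |: V).
Proof.
move=> xV [/eqP/cards2P[a [b [neq_ab Nx]]] cl] colV g gP gsym.
have adjx u : u \in V -> adj x u = (u == a) || (u == b).
  by move=> uV; have /setP/(_ u) := Nx; rewrite !inE uV andbT.
have Nab u : u \in [set a; b] -> adj x u /\ u \in V.
  by rewrite -Nx !inE => /andP.
have [xa aV] := Nab a (set21 a b); have [xb bV] := Nab b (set22 a b).
have ab : adj a b by apply: cl => //; rewrite Nx ?set21 ?set22.
have ba : adj b a by rewrite adj_sym.
have Vx u : u \in V -> (u == x) = false by move=> uV; apply: contraNF xV => /eqP<-.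
(* Testing the unordered pair changes both orientations of [ab], which keeps [g'] symmetric. *)
pose g' u v := if [set u; v] == [set a; b] then eliminate (g u v) (g u x) (g v x)
               else g u v.
have [||phi [P [phiP mP]]] := colV g'.
- by move=> u v; rewrite /g'; case: ifP => // _; apply: realizable_eliminate.
- move=> u v c d p q; rewrite /g' (setUC [set v]); case: ifP => _; last exact: gsym.
  by apply: eliminate_sym => p1 q1; apply: gsym.
have [phi_ab] := phiP a b aV bV ab; rewrite /g' eqxx.
case=> f [r] [s] [p1] [q1] [p2] [q2] [[fa fb rs] [gab gax gbx eab eba]].
pose phi' u := if u == x then f else phi u.
pose P' u v := if v == x then if u == a then p2 else q2
  else if u == x then if v == a then r else s
  else if (u == a) && (v == b) then p1 else if (u == b) && (v == a) then q1
  else P u v.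
have P'ab : P' a b = p1 by rewrite /P' !Vx ?eqxx.
have P'ba : P' b a = q1 by rewrite /P' !Vx // eqxx eq_sym (negPf neq_ab) eqxx.
have P'V u v : u \in V -> v \in V -> [set u; v] != [set a; b] -> P' u v = P u v.
  move=> uV vV; rewrite /P' !Vx //.
  case: (altP andP) => [[/eqP-> /eqP->]|_]; first by rewrite eqxx.
  by case: (altP andP) => [[/eqP-> /eqP->]|_ //]; rewrite setUC eqxx.
have P'x u : P' u x = if u == a then p2 else q2 by rewrite /P' eqxx.
have P'x' u : u \in V -> P' x u = if u == a then r else s.
  by move=> uV; rewrite /P' Vx ?eqxx.
have ba_neq : (b == a) = false by rewrite eq_sym (negPf neq_ab).
have good_x u : u \in V -> adj x u ->
    f != phi u /\ g u x (phi u) f (P' u x) (P' x u).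
  move=> uV; rewrite adjx // P'x P'x' // => /orP[] /eqP->; rewrite ?eqxx ?ba_neq //.
exists phi', P'; split.
  move=> u v /setU1P[->|uV] /setU1P[->|vV]; rewrite ?adj_irrefl // => uv.
  - rewrite /phi' eqxx Vx //; have [fv gv] := good_x v vV uv.
    by split=> //; apply: gsym.
  - rewrite /phi' eqxx Vx // eq_sym; apply: good_x => //.
    by rewrite adj_sym.
  rewrite /phi' !Vx //; have [phi_uv guv] := phiP u v uV vV uv; split=> //.
  have [e|ne] := eqVneq [set u; v] [set a; b]; last first.
    by move: guv; rewrite /g' (negPf ne) !P'V // setUC.
  have: u \in [set a; b] by rewrite -e set21.
  have: v \in [set a; b] by rewrite -e set22.
  move=> /set2P[] ev /set2P[] eu; move: uv; rewrite ev eu ?adj_irrefl // => _.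
    by rewrite P'ba P'ab; apply: gsym.
  by rewrite P'ba P'ab.
move=> v; rewrite maskU1 // => /setU1P[->|vV].
  rewrite adj_irrefl N.lxor_0_l (@eq_mask _ _ _ (fun _ u => if u == a then r else s)).
    rewrite /mask (eq_bigl (mem [set a; b])); last first.
      by move=> u; rewrite -Nx !inE andbC.
    rewrite big_setU1 ?inE //= big_set1 eqxx ba_neq.
    by apply: contra rs => /eqP/N.lxor_eq->.
  by move=> u uV _; rewrite P'x'.
rewrite adj_sym adjx // P'x; have [-> /=|va] := eqVneq v a.
  (* The total mask at [a] is unchanged: [p2] only moves from the edge [ab] to the edge [ax]. *)
  rewrite -(@mask_update _ V P _ a b) ?P'ab ?mP // => u uV au ub.
  rewrite P'V //; apply: contraNneq ub => e.
  have: u \in [set a; b] by rewrite -e set22.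
  by case/set2P=> eu; [move: au; rewrite eu adj_irrefl | rewrite eu].
have [-> /=|vb] := eqVneq v b.
  rewrite -(@mask_update _ V P _ b a) ?P'ba ?mP // => u uV bu ua.
  rewrite P'V //; apply: contraNneq ua => e.
  have: u \in [set a; b] by rewrite -e set22.
  by case/set2P=> eu; [rewrite eu | move: bu; rewrite eu adj_irrefl].
rewrite N.lxor_0_l (@eq_mask _ _ _ P) ?mP // => u uV _; rewrite P'V //.
apply: contraNneq va => e; have: v \in [set a; b] by rewrite -e set21.
by rewrite !inE (negPf vb) orbF.
Qed.

Lemma constrained_colorable_two_tree (G : sgraph) :
  two_tree G -> constrained_colorable [set: G].
Proof.
case=> s [V [[f [finj fV fadj]] <- step]].
suff col i : i <= s -> constrained_colorable (V i) by apply: col.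
elim: i => [_|i IHi lt_is]; last first.
  have [x [xV -> cl]] := step i.+1 lt_is.
  exact: constrained_colorable_extend xV cl (IHi (ltnW lt_is)).
pose i0 := @Ordinal 3 0 isT; pose i1 := @Ordinal 3 1 isT; pose i2 := @Ordinal 3 2 isT.
(* The initial triangle is itself an extension of an edge. *)
have -> : V 0 = f i2 |: [set f i0; f i1].
  rewrite -fV; apply/setP=> v; rewrite !inE; apply/imsetP/or3P.
    case=> -[[|[|[|//]]] lti] _ ->; [apply: Or32 | apply: Or33 | apply: Or31];
      by apply/eqP; congr f; apply: val_inj.
  by case=> /eqP->; [exists i2 | exists i0 | exists i1].
apply: constrained_colorable_extend; last 1 first.
- by apply: constrained_colorable_edge; rewrite fadj.
- by rewrite !inE !(inj_eq finj).
have -> : nbh (f i2) :&: [set f i0; f i1] = [set f i0; f i1].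
  by apply/setIidPr/subsetP=> v; rewrite !inE => /orP[] /eqP->; rewrite fadj.
split; first by rewrite cards2 (inj_eq finj).
by move=> u v /set2P[] -> /set2P[] ->; rewrite fadj (inj_eq finj).
Qed.

(** * From constraints back to odd colorings *)

Definition plain_constraint : constraint :=
  fun c d p q => p = color_bit d /\ q = color_bit c.

Lemma realizable_plain_constraint : realizable plain_constraint.
Proof.
exists plain_edge => [|c d p q cd]; first exact: plain_edge_gadget.
have: all (fun c => all (fun d => (c != d) ==>
    (place plain_edge c d == [:: (color_bit d, color_bit c)])) colors) colors.
  by vm_compute.
move=> /allP/(_ (c : nat)); rewrite mem_colors ltn_ord => /(_ isT).
move=> /allP/(_ (d : nat)); rewrite mem_colors ltn_ord => /(_ isT).
by rewrite (cd : nat_of_ord c != d) => /eqP->; rewrite inE => /eqP[-> ->].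
Qed.

Lemma testbit_color_bits (I : finType) (A : {pred I}) (phi : I -> nat) (i : nat) :
  N.testbit (\big[N.lxor/0%num]_(u in A) color_bit (phi u)) (N.of_nat i) =
  odd #|[set u in A | phi u == i]|.
Proof.
rewrite -sum1dep_card big_mkcondr /=.
elim/big_rec2: _ => [|u n m _ IH]; first by rewrite N.bits_0.
rewrite N.lxor_spec N.pow2_bits_eqb IH oddD.
have -> : N.eqb (N.of_nat (phi u)) (N.of_nat i) = (phi u == i).
  case: N.eqb_spec => [/Nnat.Nat2N.inj->|ne]; first by rewrite eqxx.
  by apply/esym/eqP => e; apply: ne; rewrite e.
by case: (phi u == i); case: (odd m).
Qed.

Theorem theorem1p4 (G : sgraph) : two_tree G -> odd_colorable 4 G.
Proof.
move=> /constrained_colorable_two_tree/(_ (fun _ _ => plain_constraint)).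
case=> [_ _|_ _ c d p q [-> ->] //|phi [P [phiP mP]]].
  exact: realizable_plain_constraint.
exists phi; split=> [u v uv|v _].
  by have [/eqP] := phiP u v (in_setT u) (in_setT v) uv.
have mE : mask [set: G] P v = \big[N.lxor/0%num]_(u in nbh v) color_bit (phi u).
  rewrite /mask; apply: eq_big => [u|u]; first by rewrite !inE.
  by case/andP=> _ vu; have [_ []] := phiP v u (in_setT v) (in_setT u) vu.
(* The leading bit of a nonzero mask is set, and a set bit means an odd count. *)
have [n oddn] : exists n, odd #|[set u in nbh v | nat_of_ord (phi u) == n]|.
  exists (N.to_nat (N.log2 (mask [set: G] P v))).
  by rewrite -testbit_color_bits -mE Nnat.N2Nat.id N.bit_log2 //; apply/eqP/mP.
(* An odd class is nonempty, so the natural number [n] is one of the four colors. *)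
have [u] : exists u, u \in [set u in nbh v | nat_of_ord (phi u) == n].
  by apply/set0Pn; apply: contraTneq oddn => ->; rewrite cards0.
rewrite inE => /andP[_ /eqP phiu]; exists (phi u); rewrite -phiu in oddn.
rewrite (_ : _ :&: _ = [set w in nbh v | nat_of_ord (phi w) == phi u]) //.
by apply/setP=> w; rewrite !inE andbC.
Qed.
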